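(* Let $L>0$, $r>0$ and $k_I>0$. The closed-loop linear system $$\phi_t(x,t)=-r\,\phi_x(x,t)\ \ (x\in(0,L),\,t\ge0),\qquad \dot\xi(t)=\phi(L,t),\qquad \phi(0,t)=-k_I\,\xi(t),$$ $$\phi(x,0)=\phi_0(x),\qquad \xi(0)=\xi_0,$$ with state $(\phi(\cdot,t),\xi(t))$ in $Z=L^2(0,L)\times\mathbb R$, is exponentially stable in $Z$ with respect to the $L^2$ norm if and only if $k_I\in\left(0,\dfrac{r\pi}{2L}\right)$.
   Context: $Z=L^2(0,L)\times\mathbb R$ is the Hilbert space with scalar product $\langle(\phi_a,\xi_a),(\phi_b,\xi_b)\rangle_Z=\int_0^L\phi_a\phi_b\,dx+\xi_a\xi_b$ and associated norm $\|\cdot\|_Z$. For initial data in $Z$ the solution is understood in the mild (semigroup) sense, i.e. along characteristics: $\phi(x,t)=\phi_0(x-rt)$ if $x>rt$ and $\phi(x,t)=-k_I\xi(t-x/r)$ if $x<rt$, with $\xi(t)=\xi_0+\int_0^t\phi(L,\tau)\,d\tau$. Exponentially stable in $Z$ means: there exist constants $M>0$ and $\omega>0$ such that $\|(\phi(\cdot,t),\xi(t))\|_Z\le Me^{-\omega t}\|(\phi_0,\xi_0)\|_Z$ for all $t\ge0$ and all $(\phi_0,\xi_0)\in Z$. *)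

(* Defs.v *)
From HB Require Import structures.
From mathcomp Require Import all_boot all_order all_algebra.
From mathcomp Require Import all_classical all_reals all_analysis.

Set Implicit Arguments.
Unset Strict Implicit.
Unset Printing Implicit Defensive.

Import Order.TTheory GRing.Theory Num.Theory.
Import numFieldNormedType.Exports.

Local Open Scope classical_set_scope.
Local Open Scope ring_scope.

(* Elements of L^2(0, L) are handled through representatives [R -> R]; their
   values outside ]0, L[ are irrelevant. *)
Definition in_L2 (R : realType) (L : R) (f : R -> R) : Prop :=
  measurable_fun `]0, L[ f /\
  (@lebesgue_measure R).-integrable `]0, L[ (fun x => (f x ^+ 2)%:E).

Definition in_Z (R : realType) (L : R) (z : (R -> R) * R) : Prop :=
  in_L2 L z.1.

(* [\int] is the real-valued Lebesgue integral, which is 0 by convention when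
   the integral is infinite: [dotZ] and [normZ] are only meaningful for
   arguments satisfying [in_Z]. *)
Definition dotZ (R : realType) (L : R) (za zb : (R -> R) * R) : R :=
  \int[@lebesgue_measure R]_(x in `]0, L[) (za.1 x * zb.1 x) + za.2 * zb.2.

Definition normZ (R : realType) (L : R) (z : (R -> R) * R) : R :=
  Num.sqrt (dotZ L z z).

(* Mild solution, along characteristics, of
     phi_t = - r phi_x on ]0, L[,  xi' = phi(L, .),  phi(0, .) = - kI xi
   with initial state z0 = (phi_0, xi_0).  Nothing is imposed on the line
   x = r t.  The last two clauses contain the case x = L, which defines the
   trace phi(L, .), and the case x = 0, which is the boundary condition. *)
Record mild_solution (R : realType) (L r kI : R) (z0 : (R -> R) * R)
    (phi : R -> R -> R) (xi : R -> R) : Prop := MildSolution {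
  mild_state : forall t, 0 <= t -> in_Z L (phi^~ t, xi t) ;
  mild_trace : forall t, 0 <= t ->
    (@lebesgue_measure R).-integrable `[0, t] (fun tau => (phi L tau)%:E) ;
  mild_xi : forall t, 0 <= t ->
    xi t = z0.2 + \int[@lebesgue_measure R]_(tau in `[0, t]) phi L tau ;
  mild_init : forall x t, 0 <= x <= L -> 0 <= t -> r * t < x ->
    phi x t = z0.1 (x - r * t) ;
  mild_boundary : forall x t, 0 <= x <= L -> 0 <= t -> x < r * t ->
    phi x t = - kI * xi (t - x / r) }.

Definition exponentially_stable (R : realType) (L r kI : R) : Prop :=
  exists M omega : R, [/\ 0 < M, 0 < omega &
    forall (z0 : (R -> R) * R) (phi : R -> R -> R) (xi : R -> R),
      in_Z L z0 -> mild_solution L r kI z0 phi xi ->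
      forall t, 0 <= t ->
        normZ L (phi^~ t, xi t) <= M * expR (- omega * t) * normZ L z0].

(* Main.v *)
(** Along characteristics [xi] solves the delay equation
    [xi'(t) = - kI xi (t - T)] for [t > T := L / r], and everything is decided by
    [K := kI T]; after rescaling time, [x'(t) = - x(t - a)] with [a = K].

    If [a < pi / 2], then
      [v(t) = int_(t-a)^t (x'^2 - x^2) + 2 x(t) x(t-a)]
    satisfies [v' = - (x(t) + x(t - 2a))^2], and minimizing the integral with
    fixed end values (the extremals are harmonic) shows that [v] is coercive
    exactly when [tan (a / 2) < 1]. Since [x'' + x = x(t) + x(t - 2a)], small
    dissipation means that [x] is nearly harmonic, which for [a < pi / 2] is
    incompatible with the delay equation unless [x] is small: this allows [v] to
    be corrected into a strict Lyapunov functional, whence exponential decay.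

    If [K >= pi / 2], the characteristic equation [z + K exp (- z) = 0] has a
    root with nonnegative real part, and the corresponding solution does not
    decay. *)

Require Import Defs.
From HB Require Import structures.
From mathcomp Require Import all_boot all_order all_algebra.
From mathcomp Require Import all_classical all_reals all_analysis.
From mathcomp Require Import measurable_realfun.
From mathcomp Require Import ring lra.
Import Order.TTheory GRing.Theory Num.Theory.
Import numFieldNormedType.Exports.
Local Open Scope classical_set_scope.
Local Open Scope ring_scope.

Set Implicit Arguments.
Unset Strict Implicit.

(** * Derivatives at a point, and monotonicity from their sign *)

Section derive_pointwise.
Context {R : realType}.
Implicit Types (f g : R -> R) (t a b c : R).

Lemma is_derive_add f g t a b : is_derive t 1 f a -> is_derive t 1 g b ->
  is_derive t 1 (fun s => f s + g s) (a + b).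
Proof. by move=> ? ?; exact: is_deriveD. Qed.

Lemma is_derive_opp f t a : is_derive t 1 f a ->
  is_derive t 1 (fun s => - f s) (- a).
Proof. by move=> ?; exact: is_deriveN. Qed.

Lemma is_derive_mul f g t a b : is_derive t 1 f a -> is_derive t 1 g b ->
  is_derive t 1 (fun s => f s * g s) (f t * b + g t * a).
Proof. by move=> ? ?; exact: is_deriveM. Qed.

Lemma is_derive_scale c f t a : is_derive t 1 f a ->
  is_derive t 1 (fun s => c * f s) (c * a).
Proof. by move=> ?; exact: is_deriveZ. Qed.

Lemma is_derive_sqr f t a : is_derive t 1 f a ->
  is_derive t 1 (fun s => f s ^+ 2) (2 * f t * a).
Proof.
move=> fa; under eq_fun do rewrite expr2.
by apply: (is_derive_eq (is_derive_mul fa fa)); ring.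
Qed.

Lemma is_derive_comp_affine f b c t a : is_derive (b * t + c) 1 f a ->
  is_derive t 1 (fun s => f (b * s + c)) (b * a).
Proof.
move=> fa.
have bt : is_derive t 1 (fun s : R => b * s + c) b.
  have H := is_derive_add (is_derive_scale b (is_derive_id t 1)) (is_derive_cst c t 1).
  by apply: (is_derive_eq H); rewrite mulr1 addr0.
have H := @is_derive1_comp _ f _ t a b fa bt.
by apply: (is_derive_eq H); rewrite mulrC.
Qed.

Lemma is_derive_addr f c t a : is_derive (t + c) 1 f a ->
  is_derive t 1 (fun s => f (s + c)) a.
Proof.
rewrite -{1}[t]mul1r => /is_derive_comp_affine; rewrite mul1r.
by under eq_fun do rewrite mul1r.
Qed.

Lemma is_derive_continuous f t a : is_derive t 1 f a -> {for t, continuous f}.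
Proof. by move=> [fd _]; apply/differentiable_continuous/derivable1_diffP. Qed.

Lemma is_derive_ge0_le f df a b : a <= b ->
  (forall t, a <= t <= b -> is_derive t 1 f (df t)) ->
  (forall t, a <= t <= b -> 0 <= df t) -> f a <= f b.
Proof.
move=> ab fd df0.
have [||c] := @MVT_segment R f df a b ab.
- by move=> x; rewrite in_itv/= => /andP[ax xb]; apply: fd; rewrite !ltW.
- apply: continuous_in_subspaceT => x; rewrite inE/= in_itv/= => xab.
  exact: is_derive_continuous (fd _ xab).
rewrite in_itv/= => cab fE; rewrite -subr_ge0 fE.
by rewrite mulr_ge0 ?subr_ge0// df0.
Qed.

Lemma is_derive_le0_ge f df a b : a <= b ->
  (forall t, a <= t <= b -> is_derive t 1 f (df t)) ->
  (forall t, a <= t <= b -> df t <= 0) -> f b <= f a.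
Proof.
move=> ab fd df0; rewrite -lerN2.
apply: (@is_derive_ge0_le (fun s => - f s) (fun s => - df s) _ _ ab) => t tab.
  exact: is_derive_opp (fd _ tab).
by rewrite oppr_ge0 df0.
Qed.

End derive_pointwise.

(** * The delay equation x'(t) = - x(t - a) *)

Section delay_equation.
Context {R : realType}.
Variables (a : R) (x E EE : R -> R).
Implicit Types s t u : R.
Hypotheses (a_gt0 : 0 < a) (a_lt : a < pi / 2).
(** Primitives of [x ^+ 2] are taken as data, so that integrals become differences of values and
    each integral estimate a monotonicity argument. They are required after [- a] because
    [t - 2 * a] is evaluated for [t > a]. *)
Hypothesis x_derive : forall t, 0 < t -> is_derive t 1 x (- x (t - a)).
Hypothesis E_derive : forall t, - a < t -> is_derive t 1 E (x t ^+ 2).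
Hypothesis EE_derive : forall t, - a < t -> is_derive t 1 EE (E t).

(* [int_(t-a)^t (x'^2 - x^2) + 2 x(t) x(t-a)] along solutions, [E] being a
   primitive of [x^2]. *)
Definition lyap t : R := 2 * E (t - a) - E (t - 2 * a) - E t + 2 * (x t * x (t - a)).

Lemma lyap_derive t : a < t ->
  is_derive t 1 lyap (- (x t + x (t - 2 * a)) ^+ 2).
Proof.
have a0 := a_gt0; have al := a_lt.
move=> at_; rewrite /lyap.
have ta : 0 < t - a by lra.
have xt := x_derive (lt_trans a_gt0 at_).
have xta := is_derive_addr (x_derive ta).
have Et : - a < t by lra.
have Eta : - a < t - a by lra.
have Et2a : - a < t - 2 * a by lra.
have H := is_derive_add (is_derive_add (is_derive_add
  (is_derive_scale 2 (is_derive_addr (E_derive Eta)))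
  (is_derive_opp (is_derive_addr (E_derive Et2a))))
  (is_derive_opp (E_derive Et)))
  (is_derive_scale 2 (is_derive_mul xt xta)).
apply: (is_derive_eq H).
have -> : t - a - a = t - 2 * a by ring.
ring.
Qed.

Lemma lyap_nonincreasing s t : a < s -> s <= t -> lyap t <= lyap s.
Proof.
have a0 := a_gt0; have al := a_lt.
move=> as_ st; apply: (is_derive_le0_ge st) => u /andP[su ut].
  by apply: lyap_derive; lra.
by rewrite oppr_le0 sqr_ge0.
Qed.

Let C := cos (a / 2).
Let S := sin (a / 2).

Lemma cos_half_gt0 : 0 < C.
Proof. by have a0 := a_gt0; have al := a_lt; apply: cos_gt0_pihalf; lra. Qed.

Lemma sin_half_gt0 : 0 < S.
Proof. by have a0 := a_gt0; have al := a_lt; apply: sin_gt0_pi; have := pi_gt0 R; lra. Qed.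

Lemma sin_half_lt_cos_half : S < C.
Proof.
have a0 := a_gt0; have al := a_lt.
have pi0 := pi_gt0 R.
have -> : C = sin (pi / 2 - a / 2) by rewrite -opprB sinN sinBpihalf opprK.
by rewrite /S ltr_sin ?in_itv/=; lra.
Qed.

(* The integrand [x(s-a)^2 - x(s)^2 = x'^2 - x^2] exceeds the derivative of
   [- tan th x^2 + 2 B x / cos th - B^2 tan th] (a field of extremals of
   [int x'^2 - x^2]) by a square; the choice of [B] matches the end values. *)
Lemma lyap_coercive t : a < t ->
  (1 - S / C) * (x t ^+ 2 + x (t - a) ^+ 2) <= lyap t.
Proof.
have a0 := a_gt0; have al := a_lt.
move=> at_.
have C0 := cos_half_gt0; have S0 := sin_half_gt0; have SC := sin_half_lt_cos_half.
pose y1 := x t; pose y0 := x (t - a).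
pose B := (y1 - y0) / (2 * S).
(* The shift centres the angle: it runs from [- (a / 2)] to [a / 2] as [s] runs from [t - a] to [t],
   so its cosine stays positive. *)
pose F s := E (s - a) - E s - (- (tan (s + (a / 2 - t)) * x s ^+ 2)
   + 2 * B * (x s * (cos (s + (a / 2 - t)))^-1) - B ^+ 2 * tan (s + (a / 2 - t))).
pose dF s := (- x (s - a) + tan (s + (a / 2 - t)) * x s
   - B * (cos (s + (a / 2 - t)))^-1) ^+ 2.
have F_derive s : t - a <= s <= t -> is_derive s 1 F (dF s).
  move=> /andP[tas st]; rewrite /F.
  have s0 : 0 < s by lra.
  have c0 : cos (s + (a / 2 - t)) != 0.
    by rewrite gt_eqF// cos_gt0_pihalf//; apply/andP; lra.
  have xs := x_derive s0.
  have tans := is_derive_addr (is_derive_tan c0).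
  have coss := is_derive_addr (is_derive_cos (s + (a / 2 - t))).
  have cosV := is_deriveV c0 coss.
  have Es : - a < s by lra.
  have Esa : - a < s - a by lra.
  have H := is_derive_add (is_derive_add (is_derive_addr (E_derive Esa))
    (is_derive_opp (E_derive Es)))
    (is_derive_opp (is_derive_add (is_derive_add (is_derive_opp
       (is_derive_mul tans (is_derive_sqr xs)))
       (is_derive_scale (2 * B) (is_derive_mul xs cosV)))
       (is_derive_opp (is_derive_scale (B ^+ 2) tans)))).
  apply: (is_derive_eq H).
  rewrite /dF /tan.
  have := cos2Dsin2 (s + (a / 2 - t)).
  move: c0; set c := cos _; set d := sin _ => c0 cd.
  have rel : c^-1 ^+ 2 - 1 - d ^+ 2 * c^-1 ^+ 2 = 0.
    transitivity (c^-1 ^+ 2 * (1 - (c ^+ 2 + d ^+ 2))); first by field.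
    by rewrite cd subrr mulr0.
  rewrite /GRing.scale/= -exprVn.
  transitivity ((- x (s - a) + d / c * x s - B / c) ^+ 2
      + x s ^+ 2 * (c^-1 ^+ 2 - 1 - d ^+ 2 * c^-1 ^+ 2)); first by ring.
  by rewrite rel mulr0 addr0.
have tat : t - a <= t by lra.
have := is_derive_ge0_le tat F_derive (fun _ _ => sqr_ge0 _).
have e1 : t - a + (a / 2 - t) = - (a / 2) by field.
have e2 : t + (a / 2 - t) = a / 2 by ring.
have e3 : t - a - a = t - 2 * a by ring.
rewrite /F /lyap e1 e2 e3 /tan cosN sinN -/C -/S -/y0 -/y1 {F dF F_derive} => ineq.
have C0' : C != 0 by rewrite gt_eqF.
have S0' : S != 0 by rewrite gt_eqF.
(* Even and odd parts of the end values diagonalize the lower bound, with eigenvalues [1 - S / C]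
   and [C / S - 1]. The second is [C / S > 1] times the first, so the first is the coercivity
   constant. *)
pose ye := (y1 + y0) / 2; pose yo := (y1 - y0) / 2.
have lb : 2 * (1 - S / C) * ye ^+ 2 + 2 * (C / S - 1) * yo ^+ 2
    <= 2 * E (t - a) - E (t - 2 * a) - E t + 2 * (y1 * y0).
  rewrite -subr_ge0 in ineq; rewrite -subr_ge0; apply: le_trans ineq _.
  rewrite le_eqVlt; apply/orP; left; apply/eqP.
  have rel : C / S = (S * C)^-1 - S / C.
    transitivity ((S * C)^-1 * (C ^+ 2 + S ^+ 2) - S / C).
      by field; rewrite C0' S0'.
    by rewrite cos2Dsin2 mulr1.
  rewrite rel /B /ye /yo; field; by rewrite C0' S0'.
apply: le_trans lb.
have -> : y1 ^+ 2 + y0 ^+ 2 = 2 * ye ^+ 2 + 2 * yo ^+ 2 by rewrite /ye /yo; field.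
rewrite mulrDr lerD//; first by rewrite mulrCA mulrA.
rewrite mulrCA mulrA ler_wpM2r ?sqr_ge0// ler_pM2l//.
have SC1 : S / C < 1 by rewrite ltr_pdivrMr ?mul1r.
have CS1 : C / S - 1 = (1 - S / C) * (C / S) by field; rewrite C0' S0'.
rewrite CS1; apply: ler_peMr; first by rewrite subr_ge0 ltW.
by rewrite ler_pdivlMr// mul1r ltW.
Qed.

Lemma lyap_ge0 t : a < t -> 0 <= lyap t.
Proof.
have a0 := a_gt0; have al := a_lt.
have C0 := cos_half_gt0; have SC := sin_half_lt_cos_half.
move=> at_; apply: le_trans (lyap_coercive at_).
rewrite mulr_ge0//; last by rewrite addr_ge0 ?sqr_ge0.
by rewrite subr_ge0 ler_pdivrMr ?mul1r// ltW.
Qed.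


(** * Distance to harmonic oscillations *)

Definition osc_coef : R := 1 - sin a.
Definition osc_coef' : R := cos a.

(* For a true harmonic oscillation [x'' = - x], [x'(t) = - x(t - a)] forces
   [osc = 0]; [osc'] is the conjugate combination, so that the pair
   [(osc, osc')] controls [(x(t), x(t - a))] and is rotated by the flow. *)
Definition osc t : R := osc_coef * x t - osc_coef' * x (t - a).
Definition osc' t : R := - osc_coef' * x t - osc_coef * x (t - a).

Lemma osc_coef_bounds : 0 < osc_coef /\ osc_coef <= 1.
Proof.
have a0 := a_gt0; have alt := a_lt; have pi0 := pi_gt0 R; split.
  rewrite /osc_coef subr_gt0 -(sin_pihalf R) ltr_sin ?in_itv/=; lra.
rewrite /osc_coef gerBl; apply: ltW; apply: sin_gt0_pi; lra.
Qed.

(** The matrix taking [(x t, x (t - a))] to [(osc t, osc' t)] is orthogonal up to a factor whose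
    square is [(1 - sin a)^2 + (cos a)^2 = 2 (1 - sin a)]. *)
Lemma sqr_sum_osc t :
  osc t ^+ 2 + osc' t ^+ 2 = 2 * osc_coef * (x t ^+ 2 + x (t - a) ^+ 2).
Proof.
have := cos2Dsin2 a; rewrite /osc /osc' -/osc_coef' => cs.
transitivity ((osc_coef ^+ 2 + osc_coef' ^+ 2) * (x t ^+ 2 + x (t - a) ^+ 2)); first by ring.
congr (_ * _).
have -> : osc_coef ^+ 2 + osc_coef' ^+ 2 =
    (osc_coef' ^+ 2 + sin a ^+ 2) + (1 - 2 * sin a).
  by rewrite /osc_coef; ring.
by rewrite cs /osc_coef; ring.
Qed.

(** With the companion formula for [osc'], this is a rotation forced by [x t + x (t - 2 * a)], whose
    square is the dissipation of [lyap]. Hence [- osc * osc'] has derivative [osc ^+ 2 - osc' ^+ 2]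
    up to controlled terms. *)
Lemma osc_derive t : a < t ->
  is_derive t 1 osc (osc' t + osc_coef' * (x t + x (t - 2 * a))).
Proof.
have a0 := a_gt0 => at_; rewrite /osc.
have ta : 0 < t - a by lra.
have xt := x_derive (lt_trans a_gt0 at_).
have H := is_derive_add (is_derive_scale osc_coef xt)
  (is_derive_opp (is_derive_scale osc_coef' (is_derive_addr (x_derive ta)))).
apply: (is_derive_eq H); rewrite /osc'.
have -> : t - a - a = t - 2 * a by ring.
ring.
Qed.

Lemma osc'_derive t : a < t ->
  is_derive t 1 osc' (- osc t + osc_coef * (x t + x (t - 2 * a))).
Proof.
have a0 := a_gt0 => at_; rewrite /osc'.
have ta : 0 < t - a by lra.
have xt := x_derive (lt_trans a_gt0 at_).
have H := is_derive_add (is_derive_scale (- osc_coef') xt)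
  (is_derive_opp (is_derive_scale osc_coef (is_derive_addr (x_derive ta)))).
apply: (is_derive_eq H); rewrite /osc.
have -> : t - a - a = t - 2 * a by ring.
ring.
Qed.

(* Variation of constants for [x'' + x = x(t) + x(t - 2 a)] over one delay. *)
Lemma sqr_osc_le s : a < s -> osc s ^+ 2 <= a * (lyap s - lyap (s + a)).
Proof.
have a0 := a_gt0 => as_.
(* Cauchy-Schwarz without integrals. With [w = x u + x (u - 2 a)], the function [N] has derivative
   [cos (s + a - u) w] and drops by [osc s] over [[s, s + a]]. Adding [(k^2 + w^2) / 2] to [k N']
   makes it nonnegative, and this [k] gives the best constant. *)
pose k := osc s / a.
pose N u := - (sin ((-1) * u + (s + a)) * x u) - cos ((-1) * u + (s + a)) * x (u - a).
pose G u := k * N u + (2^-1 * k ^+ 2 * u - 2^-1 * lyap u).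
pose dG u := k * (cos (s + a - u) * (x u + x (u - 2 * a)))
  + 2^-1 * (k ^+ 2 + (x u + x (u - 2 * a)) ^+ 2).
have G_derive u : s <= u <= s + a -> is_derive u 1 G (dG u).
  move=> /andP[su _]; rewrite /G /N.
  have au : a < u by lra.
  have ua : 0 < u - a by lra.
  have xu := x_derive (lt_trans a_gt0 au).
  have xua := is_derive_addr (x_derive ua).
  have sinu := is_derive_comp_affine (is_derive_sin ((-1) * u + (s + a))).
  have cosu := is_derive_comp_affine (is_derive_cos ((-1) * u + (s + a))).
  have H := is_derive_add (is_derive_scale k (is_derive_add
      (is_derive_opp (is_derive_mul sinu xu))
      (is_derive_opp (is_derive_mul cosu xua))))
    (is_derive_add (is_derive_scale (2^-1 * k ^+ 2) (is_derive_id u 1))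
       (is_derive_opp (is_derive_scale 2^-1 (lyap_derive au)))).
  apply: (is_derive_eq H); rewrite /dG.
  have -> : u - a - a = u - 2 * a by ring.
  have -> : s + a - u = -1 * u + (s + a) by ring.
  ring.
have dG_ge0 u : s <= u <= s + a -> 0 <= dG u.
  move=> _; rewrite /dG; set w := x u + _; set c := cos _.
  have c1 : c ^+ 2 <= 1 by rewrite -(cos2Dsin2 (s + a - u)) lerDl sqr_ge0.
  have -> : k * (c * w) + 2^-1 * (k ^+ 2 + w ^+ 2) =
    2^-1 * (k + c * w) ^+ 2 + 2^-1 * ((1 - c ^+ 2) * w ^+ 2) by field.
  apply: addr_ge0; apply: mulr_ge0; rewrite ?invr_ge0 ?sqr_ge0//.
  by apply: mulr_ge0; rewrite ?sqr_ge0 ?subr_ge0.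
have ssa : s <= s + a by lra.
have := is_derive_ge0_le ssa G_derive dG_ge0.
have e1 : -1 * s + (s + a) = a by ring.
have e2 : -1 * (s + a) + (s + a) = 0 by ring.
rewrite /G /N e1 e2 sin0 cos0 addrK -subr_ge0 => ineq.
rewrite -subr_ge0.
suff -> : a * (lyap s - lyap (s + a)) - osc s ^+ 2 =
  (2 * a) * (k * (- (0 * x (s + a)) - 1 * x s) +
  (2^-1 * k ^+ 2 * (s + a) - 2^-1 * lyap (s + a)) -
  (k * (- (sin a * x s) - cos a * x (s - a)) +
   (2^-1 * k ^+ 2 * s - 2^-1 * lyap s))).
  by apply: mulr_ge0 => //; rewrite mulr_ge0// ltW.
have -> : 2 * a * (k * (- (0 * x (s + a)) - 1 * x s) +
  (2^-1 * k ^+ 2 * (s + a) - 2^-1 * lyap (s + a)) -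
  (k * (- (sin a * x s) - cos a * x (s - a)) +
   (2^-1 * k ^+ 2 * s - 2^-1 * lyap s))) = 
   a * (lyap s - lyap (s + a)) + (a * k) ^+ 2 - 2 * (a * k) * osc s.
  by rewrite /osc /osc_coef /osc_coef'; field.
have -> : a * k = osc s by rewrite /k; field; rewrite gt_eqF.
ring.
Qed.

(** The term [- x t ^+ 2] is a primitive of the product [2 x(t) x(t - a)] in [lyap], since
    [x' = - x(t - a)]. *)
Definition lyap_prim t : R := 2 * EE (t - a) - EE (t - 2 * a) - EE t - x t ^+ 2.

Lemma lyap_prim_derive t : a < t -> is_derive t 1 lyap_prim (lyap t).
Proof.
have a0 := a_gt0 => at_; rewrite /lyap_prim.
have t0 : 0 < t by lra.
have Et : - a < t by lra.
have Eta : - a < t - a by lra.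
have Et2a : - a < t - 2 * a by lra.
have H := is_derive_add (is_derive_add (is_derive_add
  (is_derive_scale 2 (is_derive_addr (EE_derive Eta)))
  (is_derive_opp (is_derive_addr (EE_derive Et2a))))
  (is_derive_opp (EE_derive Et)))
  (is_derive_opp (is_derive_sqr (x_derive t0))).
by apply: (is_derive_eq H); rewrite /lyap; ring.
Qed.

(** The integral of [lyap] over [[t, t + a]]. Its derivative [lyap (t + a) - lyap t] is at most
    [- osc t ^+ 2 / a] by [sqr_osc_le], which is how dissipation of [osc] enters the strict
    functional. *)
Definition lyap_int t : R := lyap_prim (t + a) - lyap_prim t.

Lemma lyap_int_bounds t : a < t -> 0 <= lyap_int t <= a * lyap t.
Proof.
have a0 := a_gt0 => at_; have tta : t <= t + a by lra.
apply/andP; split.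
  rewrite subr_ge0; apply: (is_derive_ge0_le tta) => u /andP[tu _].
    by apply: lyap_prim_derive; lra.
  by apply: lyap_ge0; lra.
have := @is_derive_le0_ge R (fun u => lyap_prim u + - (lyap t * u))
  (fun u => lyap u + - (lyap t * 1)) _ _ tta.
have H : forall u : R, t <= u <= t + a -> is_derive u 1 (fun u => lyap_prim u + - (lyap t * u))
    (lyap u + - (lyap t * 1)).
  move=> u /andP[tu _]; have au : a < u by lra.
  exact: is_derive_add (lyap_prim_derive au)
    (is_derive_opp (is_derive_scale _ (is_derive_id u 1))).
move=> /(_ H) K.
rewrite /lyap_int; have : lyap_prim (t + a) - lyap t * (t + a) <= lyap_prim t - lyap t * t.
  apply: K => u /andP[tu _]; rewrite mulr1 subr_le0.
  exact: lyap_nonincreasing.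
by move=> ?; lra.
Qed.

(* [int_(t-2a)^t (E(t) - E(s)) ds]: its derivative dissipates the history of
   [x^2] over two delays. *)
Definition memory t : R := 2 * a * E t - EE t + EE (t - 2 * a).

Lemma E_nondecreasing s t : - a < s -> s <= t -> E s <= E t.
Proof.
move=> as_ st; apply: (is_derive_ge0_le st) => u /andP[su _].
  by apply: E_derive; lra.
exact: sqr_ge0.
Qed.

Lemma memory_derive t : a < t ->
  is_derive t 1 memory (2 * a * x t ^+ 2 - (E t - E (t - 2 * a))).
Proof.
have a0 := a_gt0 => at_; rewrite /memory.
have Et : - a < t by lra.
have Et2a : - a < t - 2 * a by lra.
have H := is_derive_add (is_derive_add (is_derive_scale (2 * a) (E_derive Et))
  (is_derive_opp (EE_derive Et))) (is_derive_addr (EE_derive Et2a)).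
by apply: (is_derive_eq H); ring.
Qed.

(** As [E] is nondecreasing, the integrand [E t - E s] lies between [0] and [E t - E (t - 2 * a)] on
    an interval of length [2 * a]. *)
Lemma memory_bounds t : a < t -> 0 <= memory t <= 2 * a * (E t - E (t - 2 * a)).
Proof.
have a0 := a_gt0 => at_; have tat : t - 2 * a <= t by lra.
have H c (u : R) : t - 2 * a <= u <= t ->
    is_derive u 1 (fun u => c * u + - EE u) (c * 1 + - E u).
  move=> /andP[tu ut]; have au : - a < u by lra.
  exact: is_derive_add (is_derive_scale _ (is_derive_id u 1))
    (is_derive_opp (EE_derive au)).
have h1 : E t * (t - 2 * a) - EE (t - 2 * a) <= E t * t - EE t.
  apply: (is_derive_ge0_le tat (H (E t))) => u /andP[tu ut].
  by rewrite mulr1 subr_ge0; apply: E_nondecreasing => //; lra.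
have h2 : E (t - 2 * a) * t - EE t <= E (t - 2 * a) * (t - 2 * a) - EE (t - 2 * a).
  apply: (is_derive_le0_ge tat (H (E (t - 2 * a)))) => u /andP[tu ut].
  by rewrite mulr1 subr_le0; apply: E_nondecreasing => //; lra.
by rewrite /memory; apply/andP; split; lra.
Qed.

(** * The strict Lyapunov functional *)

Definition coercivity : R := 1 - S / C.

Lemma coercivity_bounds : 0 < coercivity /\ coercivity <= 1.
Proof.
have C0 := cos_half_gt0; have S0 := sin_half_gt0; have SC := sin_half_lt_cos_half.
rewrite /coercivity; split; first by rewrite subr_gt0 ltr_pdivrMr ?mul1r.
by rewrite gerBl divr_ge0// ltW.
Qed.

(** The summand [coercivity^-1] lets [lyap] absorb [osc * osc'], for positivity; the summand [1]
    leaves [lyap] itself as a lower bound. In the derivative, a weight at least [1] pays for the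
    cross terms. *)
Definition lyap_weight : R := 1 + coercivity^-1.
(** Chosen so that the growth [2 a x^2] of [memory] costs [osc_coef / 2 * x^2], half of the
    available dissipation. *)
Definition memory_weight : R := osc_coef / (4 * a).

(* [lyap] decreases strictly only where [x(t) + x(t - 2a) <> 0]; this corrected
   functional decreases at a rate proportional to [energy]. *)
Definition slyap t : R :=
  lyap_weight * lyap t + 2 * a * lyap_int t - osc t * osc' t + memory_weight * memory t.

Definition energy t : R := x t ^+ 2 + x (t - a) ^+ 2 + (E t - E (t - 2 * a)).

Lemma memory_weight_gt0 : 0 < memory_weight.
Proof.
have a0 := a_gt0; have [al0 _] := osc_coef_bounds.
by rewrite divr_gt0// mulr_gt0.
Qed.

Lemma osc_mul_le t : `|osc t * osc' t| <= x t ^+ 2 + x (t - a) ^+ 2.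
Proof.
have [al0 al1] := osc_coef_bounds.
apply: (@le_trans _ _ (osc_coef * (x t ^+ 2 + x (t - a) ^+ 2))); last first.
  by rewrite ler_piMl// addr_ge0 ?sqr_ge0.
have := sqr_sum_osc t; have := sqr_ge0 (osc t - osc' t).
have := sqr_ge0 (osc t + osc' t); rewrite sqrrB sqrrD ler_norml => *.
by apply/andP; split; lra.
Qed.

(** By coercivity, [coercivity^-1 * lyap] dominates [osc * osc']; the other corrections being
    nonnegative, [lyap <= slyap]. *)
Lemma slyap_lower t : a < t -> x t ^+ 2 <= lyap_weight * slyap t.
Proof.
have a0 := a_gt0 => at_.
have e0 := memory_weight_gt0; have [c0 c1] := coercivity_bounds.
have /andP[i0 _] := lyap_int_bounds at_.
have /andP[d0 _] := memory_bounds at_.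
have /ler_normlP [_ om] := osc_mul_le t.
have co := lyap_coercive at_; rewrite -/coercivity in co.
have ci0 : 0 < coercivity^-1 by rewrite invr_gt0.
have P : x t ^+ 2 + x (t - a) ^+ 2 <= coercivity^-1 * lyap t.
  by rewrite -(ler_pM2l c0) mulrA divff ?gt_eqF// mul1r.
have vs : lyap t <= slyap t.
  rewrite /slyap /lyap_weight.
  have := mulr_ge0 (ltW e0) d0.
  have : 0 <= 2 * a * lyap_int t by rewrite mulr_ge0// mulr_ge0// ltW.
  by move=> *; lra.
have v0 := lyap_ge0 at_.
have x2 := sqr_ge0 (x (t - a)).
rewrite /lyap_weight mulrDl mul1r.
have : coercivity^-1 * lyap t <= coercivity^-1 * slyap t by rewrite ler_pM2l.
by move=> *; lra.
Qed.

Definition slyap_growth : R := lyap_weight + 2 * a ^+ 2 + 2.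

Lemma slyap_upper t : a < t -> slyap t <= slyap_growth * energy t.
Proof.
have a0 := a_gt0 => at_.
have e0 := memory_weight_gt0; have [c0 c1] := coercivity_bounds.
have [al0 al1] := osc_coef_bounds.
have /andP[_ iu] := lyap_int_bounds at_.
have /andP[_ du] := memory_bounds at_.
have /ler_normlP [om _] := osc_mul_le t.
have ci0 : 0 < coercivity^-1 by rewrite invr_gt0.
have A0 : 0 < lyap_weight by rewrite /lyap_weight; lra.
have E1 : E (t - a) <= E t by apply: E_nondecreasing; lra.
have E2 : E (t - 2 * a) <= E (t - a) by apply: E_nondecreasing; lra.
have P1 := sqr_ge0 (x t); have P2 := sqr_ge0 (x (t - a)).
have vu : lyap t <= energy t.
  rewrite /lyap /energy.
  have := sqr_ge0 (x t - x (t - a)); rewrite sqrrB => ?; lra.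
have h1 : lyap_weight * lyap t <= lyap_weight * energy t by rewrite ler_pM2l.
have h2 : 2 * a * lyap_int t <= 2 * a ^+ 2 * energy t.
  rewrite expr2 mulrA -[leRHS]mulrA ler_pM2l ?mulr_gt0//.
  by apply: le_trans iu _; rewrite ler_pM2l.
have h3 : memory_weight * memory t <= E t - E (t - 2 * a).
  have half : osc_coef / 2 <= 1 by lra.
  apply: (@le_trans _ _ (osc_coef / 2 * (E t - E (t - 2 * a)))); last first.
    by rewrite ler_piMl// subr_ge0 (le_trans E2).
  have -> : osc_coef / 2 * (E t - E (t - 2 * a)) =
      memory_weight * (2 * a * (E t - E (t - 2 * a))).
    by rewrite /memory_weight; field; rewrite gt_eqF.
  by rewrite ler_pM2l.
have h5 : - (osc t * osc' t) + (E t - E (t - 2 * a)) <= energy t by rewrite lerD.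
have h6 : 0 <= energy t.
  by apply: addr_ge0; [apply: addr_ge0|rewrite subr_ge0 (le_trans E2)].
rewrite /slyap /slyap_growth.
by lra.
Qed.

Definition slyap_rate : R := Num.min (osc_coef / 2) memory_weight.

Lemma slyap_derive_le t : a < t ->
  exists2 d, is_derive t 1 slyap d & d <= - (slyap_rate * energy t).
Proof.
have a0 := a_gt0 => at_.
have [al0 al1] := osc_coef_bounds.
have ata : a < t + a by lra.
have pd := lyap_prim_derive at_.
have pda := is_derive_addr (lyap_prim_derive ata).
have H := is_derive_add (is_derive_add (is_derive_add
  (is_derive_scale lyap_weight (lyap_derive at_))
  (is_derive_scale (2 * a) (is_derive_add pda (is_derive_opp pd))))
  (is_derive_opp (is_derive_mul (osc_derive at_) (osc'_derive at_))))
  (is_derive_scale memory_weight (memory_derive at_)).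
eexists; first exact: H.
(* Apart from cross terms with [w], [- osc * osc'] contributes [h^2 - m^2] and [2 * a * lyap_int] at
   most [- 2 h^2]: in all [- (h^2 + m^2)]. The cross terms cost [w^2], covered by [lyap_weight], and
   half of [h^2 + m^2]. The other half is [osc_coef * P], of which [memory] consumes at most
   half. *)
set w := x t + _; set h := osc t; set m := osc' t.
have hb := sqr_osc_le at_; rewrite -/h in hb.
have hm := sqr_sum_osc t; rewrite -/h -/m in hm.
set P := x t ^+ 2 + x (t - a) ^+ 2 in hm *.
set F := E t - E (t - 2 * a).
have F0 : 0 <= F by rewrite subr_ge0; apply: E_nondecreasing; lra.
have P0 : 0 <= P by rewrite addr_ge0 ?sqr_ge0.
have [c0 c1] := coercivity_bounds.
have Aw : w ^+ 2 <= lyap_weight * w ^+ 2.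
  by rewrite ler_peMl ?sqr_ge0// /lyap_weight lerDl invr_ge0 ltW.
have be1 : osc_coef' ^+ 2 <= 1 by rewrite -(cos2Dsin2 a) lerDl sqr_ge0.
have hw : - (osc_coef * h * w) <= 2^-1 * (w ^+ 2 + h ^+ 2).
  have := sqr_ge0 (osc_coef * h + w).
  have : (osc_coef * h) ^+ 2 <= h ^+ 2.
    by rewrite exprMn ler_piMl ?sqr_ge0// expr_le1// ltW.
  by rewrite sqrrD => *; lra.
have mw : - (osc_coef' * m * w) <= 2^-1 * (w ^+ 2 + m ^+ 2).
  have := sqr_ge0 (osc_coef' * m + w).
  have : (osc_coef' * m) ^+ 2 <= m ^+ 2 by rewrite exprMn ler_piMl ?sqr_ge0.
  by rewrite sqrrD => *; lra.
have ex : memory_weight * (2 * a * x t ^+ 2) <= osc_coef / 2 * P.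
  have -> : memory_weight * (2 * a * x t ^+ 2) = osc_coef / 2 * x t ^+ 2.
    by rewrite /memory_weight; field; rewrite gt_eqF.
  by rewrite ler_wpM2l ?lerDl ?sqr_ge0//; lra.
have r1 : slyap_rate * P <= osc_coef / 2 * P by rewrite ler_wpM2r// /slyap_rate ge_min lexx.
have r2 : slyap_rate * F <= memory_weight * F.
  by rewrite ler_wpM2r// /slyap_rate ge_min lexx orbT.
have -> : energy t = P + F by [].
lra.
Qed.

Lemma slyap_rate_gt0 : 0 < slyap_rate.
Proof.
have [al0 al1] := osc_coef_bounds; rewrite /slyap_rate lt_min memory_weight_gt0 andbT.
by rewrite divr_gt0.
Qed.

Lemma lyap_weight_gt0 : 0 < lyap_weight.
Proof.
have [k0 _] := coercivity_bounds; rewrite /lyap_weight.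
have : 0 < coercivity^-1 by rewrite invr_gt0.
by move=> ?; lra.
Qed.

Lemma slyap_growth_gt0 : 0 < slyap_growth.
Proof.
have := lyap_weight_gt0; have := sqr_ge0 a; rewrite /slyap_growth => *; lra.
Qed.

Lemma slyap_decay t : 2 * a <= t ->
  slyap t <= expR (- (slyap_rate / slyap_growth) * (t - 2 * a)) * slyap (2 * a).
Proof.
have a0 := a_gt0 => at_.
have r0 := slyap_rate_gt0; have g0 := slyap_growth_gt0.
pose w := slyap_rate / slyap_growth.
have w0 : 0 < w by rewrite divr_gt0.
pose G u := expR (w * u + - (w * (2 * a))) * slyap u.
(* ['D_1 slyap] names the derivative that [slyap_derive_le] provides only existentially. *)
pose dG u := expR (w * u + - (w * (2 * a))) * (w * slyap u + 'D_1 slyap u).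
have G_derive u : 2 * a <= u <= t -> is_derive u 1 G (dG u).
  move=> /andP[au _]; have {}au : a < u by lra.
  have [d dd _] := slyap_derive_le au.
  have H := is_derive_mul
    (is_derive_comp_affine (is_derive_expR (w * u + - (w * (2 * a))))) dd.
  by apply: (is_derive_eq H); rewrite /dG derive_val; ring.
have dG_le0 u : 2 * a <= u <= t -> dG u <= 0.
  move=> /andP[au _]; have {}au : a < u by lra.
  have [d dd dle] := slyap_derive_le au.
  rewrite /dG derive_val pmulr_rle0 ?expR_gt0//.
  have : w * slyap u <= slyap_rate * energy u.
    apply: (@le_trans _ _ (w * (slyap_growth * energy u))).
      by rewrite ler_pM2l// slyap_upper.
    by rewrite mulrA /w divfK// gt_eqF.
  by move=> ?; lra.
have := is_derive_le0_ge at_ G_derive dG_le0.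
rewrite /G subrr expR0 mul1r => h.
rewrite -(ler_pM2l (expR_gt0 (w * t + - (w * (2 * a))))) [leRHS]mulrA -expRD.
rewrite [X in _ <= expR X * _](_ : _ = 0) ?expR0 ?mul1r//.
by rewrite /w; ring.
Qed.

(** Decay is started at [2 * a], where [energy] sees [x] only on [[0, 2 * a]] and is therefore at
    most [(2 * a + 2) * B ^+ 2]. *)
Lemma sqr_solution_decay (B : R) : (forall t, 0 <= t <= 2 * a -> `|x t| <= B) ->
  forall t, 2 * a <= t ->
  x t ^+ 2 <= lyap_weight * slyap_growth * (2 * a + 2) *
    expR (- (slyap_rate / slyap_growth) * (t - 2 * a)) * B ^+ 2.
Proof.
have a0 := a_gt0 => xB t at_.
have a2a : a < 2 * a by lra.
have {}xB u : 0 <= u <= 2 * a -> x u ^+ 2 <= B ^+ 2.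
  by move=> /xB xuB; rewrite -real_normK ?num_real// ler_sqr ?nnegrE// (le_trans _ xuB).
have sz : energy (2 * a) <= (2 * a + 2) * B ^+ 2.
  have x1 : x (2 * a) ^+ 2 <= B ^+ 2 by apply: xB; lra.
  have x2 : x (2 * a - a) ^+ 2 <= B ^+ 2 by apply: xB; lra.
  have a2 : 2 * a - 2 * a <= 2 * a by lra.
  have := @is_derive_le0_ge R (fun u => E u + - (B ^+ 2 * u))
    (fun u => x u ^+ 2 + - (B ^+ 2 * 1)) _ _ a2.
  move=> H; have : E (2 * a) + - (B ^+ 2 * (2 * a)) <=
     E (2 * a - 2 * a) + - (B ^+ 2 * (2 * a - 2 * a)).
    apply: H => u /andP[u0 u1].
      have au : - a < u by lra.
      exact: is_derive_add (E_derive au)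
        (is_derive_opp (is_derive_scale _ (is_derive_id u 1))).
    by rewrite mulr1 subr_le0; apply: xB; lra.
  by rewrite /energy => ?; lra.
have at1 : a < t by lra.
apply: le_trans (slyap_lower at1) _.
rewrite -!mulrA ler_pM2l ?lyap_weight_gt0//.
apply: le_trans (slyap_decay at_) _.
set e := expR _.
have -> : slyap_growth * ((2 * a + 2) * (e * B ^+ 2)) =
  e * (slyap_growth * ((2 * a + 2) * B ^+ 2)) by ring.
rewrite ler_pM2l ?expR_gt0//.
apply: le_trans (slyap_upper a2a) _.
by rewrite ler_pM2l// slyap_growth_gt0.
Qed.

End delay_equation.

(** The constants are chosen before the solution: this uniformity is what exponential stability
    demands. *)
Lemma delay_decay (R : realType) (a : R) : 0 < a -> a < pi / 2 ->
  exists2 K : R, 0 < K & exists2 w : R, 0 < w &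
  forall x E EE : R -> R,
    (forall t : R, 0 < t -> is_derive t 1 x (- x (t - a))) ->
    (forall t : R, - a < t -> is_derive t 1 E (x t ^+ 2)) ->
    (forall t : R, - a < t -> is_derive t 1 EE (E t)) ->
    forall B : R, (forall t : R, 0 <= t <= 2 * a -> `|x t| <= B) ->
    forall t : R, 2 * a <= t -> x t ^+ 2 <= K * expR (- w * t) * B ^+ 2.
Proof.
move=> a0 alt.
have r0 := slyap_rate_gt0 a0 alt; have g0 := slyap_growth_gt0 a0 alt.
have w0 := lyap_weight_gt0 a0 alt.
exists (lyap_weight a * slyap_growth a * (2 * a + 2) *
  expR (slyap_rate a / slyap_growth a * (2 * a))).
  rewrite mulr_gt0 ?expR_gt0// mulr_gt0 ?mulr_gt0//; lra.
exists (slyap_rate a / slyap_growth a); first exact: divr_gt0.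
move=> x E EE xD ED EED B xB t at_.
apply: le_trans (sqr_solution_decay a0 alt xD ED EED xB at_) _.
rewrite le_eqVlt; apply/orP; left; apply/eqP; congr (_ * _).
rewrite -[RHS]mulrA -expRD; congr (_ * expR _); ring.
Qed.

(** * Existence of primitives and rescaling of time *)

Section rescaling.
Context {R : realType}.
Notation mu := (@lebesgue_measure R).

Lemma primitive_exists (f : R -> R) (b : R) :
  (forall t : R, b <= t -> {for t, continuous f}) ->
  exists F : R -> R, forall t : R, b < t -> is_derive t 1 F (f t).
Proof.
move=> cf; exists (fun t => \int[mu]_(s in `[b, t]) f s) => t bt.
have tt1 : t < t + 1 by rewrite ltrDl.
have fi : mu.-integrable `[b, t + 1] (EFin \o f).
  apply: continuous_compact_integrable; first exact: segment_compact.
  apply: continuous_in_subspaceT => s; rewrite inE/= in_itv/= => /andP[bs _].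
  exact: cf.
have [Fd FE] := continuous_FTC1_closed tt1 fi bt (cf _ (ltW bt)).
by apply: (DeriveDef Fd); rewrite -derive1E.
Qed.

Lemma delay_decay_scaled (k T : R) : 0 < k -> 0 < T -> k * T < pi / 2 ->
  exists2 M : R, 0 < M & exists2 w : R, 0 < w &
  forall xi : R -> R,
    (forall t : R, T < t -> is_derive t 1 xi (- k * xi (t - T))) ->
    forall B : R, (forall t : R, 0 <= t <= 5 * T -> `|xi t| <= B) ->
    forall t : R, 0 <= t -> `|xi t| <= M * expR (- w * t) * B.
Proof.
move=> k0 T0 kT; have a0 : 0 < k * T by rewrite mulr_gt0.
have [K K0 [w w0 H]] := delay_decay a0 kT.
(* The factor [k] comes from the time scale, and the half from taking the square root of a bound on
   the square. *)
pose v := w * k / 2.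
have v0 : 0 < v by rewrite /v divr_gt0// mulr_gt0.
(* The first entry serves times up to [5 * T], where only the bound [B] is available; the second
   serves later times. *)
pose M := Num.max (expR (v * (5 * T))) (Num.sqrt K * expR (v * (3 * T))).
exists M; first by rewrite lt_max expR_gt0.
exists v => // xi xiD B xiB t t0.
have B0 : 0 <= B by apply: le_trans (xiB 0 _); rewrite ?lexx//=; lra.
have [t5|t5] := leP t (5 * T).
  apply: le_trans (xiB _ _) _; first by rewrite t0.
  rewrite ler_peMl//.
  apply: (@le_trans _ _ (expR (v * (5 * T)) * expR (- v * t))).
    rewrite -expRD -[leLHS]expR0 ler_expR mulNr -mulrBr mulr_ge0 ?subr_ge0//.
    exact: ltW.
  by rewrite ler_pM2r ?expR_gt0// /M le_max lexx.
pose a := k * T.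
(* The origin is moved to [3 * T], so that the equation holds already for [s > - 2 * a], which
   leaves room for two primitives. The history [[0, 2 * a]] becomes [[3 * T, 5 * T]]. *)
pose x s := xi (k^-1 * s + 3 * T).
have k1 : k^-1 * k = 1 by rewrite mulVf// gt_eqF.
have ka : k^-1 * a = T by rewrite /a mulrA k1 mul1r.
have arg (s c : R) : c * a < s -> (c + 3) * T < k^-1 * s + 3 * T.
  by rewrite -(ltr_pM2l (_ : 0 < k^-1)) ?invr_gt0// mulrCA ka => ?; lra.
have xD (s : R) : - 2 * a < s -> is_derive s 1 x (- x (s - a)).
  move=> /arg hs; have {}hs : T < k^-1 * s + 3 * T by lra.
  apply: (is_derive_eq (is_derive_comp_affine (xiD _ hs))).
  rewrite mulrA mulrN k1 mulN1r /x; congr (- xi _).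
  by rewrite mulrBr ka; ring.
have aR0 : 0 < a by [].
(* A primitive is obtained only strictly after its base point, hence the staggered bounds [- 2 a],
   [- 3/2 a], [- 5/4 a], all before the required [- a]. *)
have [E ED] : exists E : R -> R, forall s : R, - (3 / 2) * a < s ->
    is_derive s 1 E (x s ^+ 2).
  apply: (@primitive_exists (fun s => x s ^+ 2)) => s hs.
  have {}hs : - 2 * a < s by lra.
  exact: is_derive_continuous (is_derive_sqr (xD _ hs)).
have [EE EED] : exists EE : R -> R, forall s : R, - (5 / 4) * a < s ->
    is_derive s 1 EE (E s).
  apply: primitive_exists => s hs.
  have {}hs : - (3 / 2) * a < s by lra.
  exact: is_derive_continuous (ED _ hs).
have h1 (s : R) : 0 < s -> is_derive s 1 x (- x (s - a)).
  by move=> s0; apply: xD; lra.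
have h2 (s : R) : - a < s -> is_derive s 1 E (x s ^+ 2).
  by move=> s0; apply: ED; lra.
have h3 (s : R) : - a < s -> is_derive s 1 EE (E s).
  by move=> s0; apply: EED; lra.
have h4 (s : R) : 0 <= s <= 2 * a -> `|x s| <= B.
  have kV : 0 < k^-1 by rewrite invr_gt0.
  move=> /andP[s0 s2a]; apply: xiB.
  have h0 := mulr_ge0 (ltW kV) s0.
  have : k^-1 * s <= k^-1 * (2 * a) by rewrite ler_pM2l.
  by rewrite mulrCA ka => ?; apply/andP; split; lra.
have h5 : 2 * a <= k * (t - 3 * T) by rewrite /a mulrCA ler_pM2l//; lra.
have := H x E EE h1 h2 h3 B h4 _ h5.
have -> : x (k * (t - 3 * T)) = xi t.
  by rewrite /x mulrA k1; congr xi; ring.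
move=> h.
have /le_trans -> // : `|xi t| <= Num.sqrt K * expR (v * (3 * T)) * expR (- v * t) * B.
  rewrite -ler_sqr ?nnegrE ?mulr_ge0 ?sqrtr_ge0 ?expR_ge0//.
  rewrite real_normK ?num_real//; apply: le_trans h _.
  rewrite le_eqVlt; apply/orP; left; apply/eqP.
  rewrite !exprMn sqr_sqrtr ?(ltW K0)//; congr (_ * _).
  rewrite -[RHS]mulrA -exprMn -expRD -expRM_natr. congr (_ * expR _).
  by rewrite /v; field.
by rewrite ler_wpM2r// ler_pM2r ?expR_gt0// /M le_max lexx orbT.
Qed.
End rescaling.

(** * Mild solutions *)

Section affine_change_of_variable.
Context {R : realType}.
Notation mu := (@lebesgue_measure R).
Local Open Scope ereal_scope.

Let affine_measurable (c d : R) :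
  measurable_fun [set: measurableTypeR R] (fun x : R => (c * x + d)%R : measurableTypeR R).
Proof. by apply: measurable_funD => //; exact: mulrl_measurable. Qed.

Let image_measure (c d : R) : {measure set (measurableTypeR R) -> \bar R} :=
  measure_function_pushforward__canonical__measure_function_Measure mu
    (affine_measurable c d).

(** By uniqueness of the Lebesgue measure, intervals []a, b]] suffice; for negative [c] the preimage
    is closed on the other side, which leaves its length unchanged. *)
Lemma lebesgue_measure_affine (c d : R) (A : set R) : c != 0%R -> measurable A ->
  mscale (`|c|%:nng)%R (image_measure c d) A = mu A.
Proof.
move=> c0 mA; apply/esym; apply: lebesgue_measure_unique => //= _ [[a b]] _ <- /=.
rewrite /mscale/= /pushforward.
have [c_gt0|c_lt0|c_eq0] := ltrgtP 0%R c; last by rewrite -c_eq0 eqxx in c0.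
- rewrite (_ : _ @^-1` _ = `](a - d) / c, (b - d) / c]%classic)%R; last first.
    apply/seteqP; split=> x /=; rewrite !in_itv/=;
    by rewrite ltr_pdivrMr// ler_pdivlMr// ltrBlDr lerBrDr mulrC.
  rewrite !lebesgue_measure_itv/= !lte_fin ltr_pM2r ?invr_gt0// ltrD2r.
  case: ifPn => // _; rewrite ?mule0// gtr0_norm// -!EFinD -EFinM; congr EFin.
  by field.
- rewrite (_ : _ @^-1` _ = `[(b - d) / c, (a - d) / c[%classic)%R; last first.
    apply/seteqP; split=> x /=; rewrite !in_itv/=;
    by rewrite andbC ler_ndivrMr// ltr_ndivlMr// ltrBlDr lerBrDr mulrC.
  rewrite !lebesgue_measure_itv/= !lte_fin ltr_nM2r ?invr_lt0// ltrD2r.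
  case: ifPn => // _; rewrite ?mule0// ltr0_norm// -!EFinD -EFinM; congr EFin.
  by field.
Qed.

Lemma ge0_integral_affine (c d : R) (D : set R) (f : R -> \bar R) :
  c != 0%R -> measurable D -> measurable_fun D f -> (forall x, D x -> 0 <= f x) ->
  \int[mu]_(y in D) f y =
  `|c|%:E * \int[mu]_(x in (fun x => c * x + d)%R @^-1` D) f (c * x + d)%R.
Proof.
move=> c0 mD mf f0.
rewrite (eq_measure_integral
  (mscale (`|c|%:nng)%R (image_measure c d))); last first.
  by move=> A mA _; apply/esym; exact: lebesgue_measure_affine.
rewrite ge0_integral_mscale//= ge0_integral_pushforward//.
by move=> y; rewrite inE; exact: f0.
Qed.

End affine_change_of_variable.

(** * Estimates in [L^2] *)

Section L2_bounds.
Context {R : realType}.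
Notation mu := (@lebesgue_measure R).
Implicit Types (L eta : R) (z : (R -> R) * R).

Lemma dotZ_self_ge0 L z : 0 <= dotZ L z z.
Proof.
apply: addr_ge0; last by rewrite -expr2 sqr_ge0.
by apply: Rintegral_ge0 => x _; rewrite -expr2 sqr_ge0.
Qed.

(** Integrability, contained in [in_Z], makes the extended integral finite, so the default value of
    the real integral does not interfere. *)
Lemma normZ_le L z eta : 0 <= eta -> in_Z L z -> normZ L z <= eta ->
  (\int[mu]_(x in `]0%R, L[) (z.1 x ^+ 2)%:E <= (eta ^+ 2)%:E)%E /\
  `|z.2| <= eta.
Proof.
move=> eta0 [mz iz] zeta.
have dz : dotZ L z z <= eta ^+ 2.
  by rewrite -(sqr_sqrtr (dotZ_self_ge0 L z)) lerXn2r ?nnegrE ?sqrtr_ge0.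
have i0 : 0 <= \int[mu]_(x in `]0, L[) (z.1 x * z.1 x).
  by apply: Rintegral_ge0 => x _; rewrite -expr2 sqr_ge0.
have z0 : 0 <= z.2 * z.2 by rewrite -expr2 sqr_ge0.
rewrite /dotZ in dz; split.
  rewrite -[leLHS]fineK ?lee_fin; last exact: integrable_fin_num.
  under eq_integral do rewrite expr2.
  by apply: le_trans dz; rewrite lerDl.
by rewrite -ler_sqr ?nnegrE// real_normK ?num_real// expr2 (le_trans _ dz)// lerDr.
Qed.

Lemma le_normZ L z (c eta : R) : 0 <= c -> 0 <= eta -> in_Z L z ->
  (\int[mu]_(x in `]0%R, L[) (z.1 x ^+ 2)%:E <= (c * eta ^+ 2)%:E)%E ->
  forall d, `|z.2| <= d * eta ->
  normZ L z <= Num.sqrt (c + d ^+ 2) * eta.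
Proof.
move=> c0 eta0 [mz iz] zeta d zd.
rewrite -[X in _ * X](ger0_norm eta0) -sqrtr_sqr -sqrtrM; last first.
  by rewrite addr_ge0// sqr_ge0.
apply: ler_wsqrtr; rewrite mulrDl /dotZ lerD//.
  rewrite /Rintegral -lee_fin fineK; last first.
    by under eq_integral do rewrite -expr2; exact: integrable_fin_num.
  by under eq_integral do rewrite -expr2.
rewrite -exprMn -expr2 -real_normK ?num_real// lerXn2r ?nnegrE//.
exact: le_trans zd.
Qed.

(* [|f| <= (eta + f ^ 2 / eta) / 2] replaces the Cauchy-Schwarz inequality. *)
Lemma norm_Rintegral_reflected_le L (r : R) (f : R -> R) (b eta : R) :
  0 < L -> 0 < r -> 0 < eta -> 0 <= b <= L / r ->
  measurable_fun `]0, L[ f ->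
  (\int[mu]_(x in `]0%R, L[) (f x ^+ 2)%:E <= (eta ^+ 2)%:E)%E ->
  mu.-integrable `[0, b[ (EFin \o (fun t => f (L - r * t))) ->
  `|\int[mu]_(t in `[0, b[) f (L - r * t)| <= (L + 1) / r * eta.
Proof.
move=> L0 r0 eta0 /andP[b0 bLr] mf fL2 ig.
(* This majorant of [|f|] integrates to at most [(L + 1) * eta / 2] over []0, L[]; the reflection
   [y = L - r t] carries the bound to []0, L / r[]. *)
pose h y : \bar R := (eta / 2 + (2 * eta)^-1 * f y ^+ 2)%:E.
have mh : measurable_fun `]0%R, L[ h.
  apply/measurable_EFinP/measurable_funD => //.
  by apply: measurable_funM => //; exact: measurable_funX.
have eV : 0 <= (2 * eta)^-1 by rewrite invr_ge0 mulr_ge0// ltW.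
have h0 y : (0 <= h y)%E.
  rewrite /h lee_fin addr_ge0 ?divr_ge0 ?(ltW eta0)//.
  by rewrite mulr_ge0// sqr_ge0.
have hL : (\int[mu]_(y in `]0%R, L[) h y <= ((L + 1) * eta / 2)%:E)%E.
  rewrite /h; under eq_integral do rewrite EFinD [X in (_ + X)%E]EFinM.
  rewrite ge0_integralD//; last first.
  - by apply/measurable_EFinP; apply: measurable_funM => //; exact: measurable_funX.
  - by move=> y _; rewrite -EFinM lee_fin mulr_ge0// sqr_ge0.
  - by move=> y _; rewrite lee_fin divr_ge0// ltW.
  rewrite ge0_integralZl_EFin//; last 2 first.
  - by move=> y _; rewrite lee_fin sqr_ge0.
  - by apply/measurable_EFinP; exact: measurable_funX.
  rewrite integral_cst//= lebesgue_measure_itv/= lte_fin L0 sube0 -EFinM.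
  apply: (@le_trans _ _ ((eta / 2 * L)%:E + ((2 * eta)^-1)%:E * (eta ^+ 2)%:E)%E).
    by rewrite leeD2l// lee_wpmul2l.
  rewrite -EFinM -EFinD lee_fin le_eqVlt; apply/orP; left; apply/eqP.
  by field; rewrite gt_eqF.
have := @ge0_integral_affine R (- r) L `]0, L[%classic h.
rewrite oppr_eq0 gt_eqF// => /(_ isT (measurable_itv _) mh (fun x _ => h0 x)).
rewrite normrN (gtr0_norm r0) => hE.
rewrite {}hE in hL.
have pre : (fun x => - r * x + L) @^-1` `]0, L[%classic = `]0, L / r[%classic.
  apply/seteqP; split=> x /=; rewrite !in_itv/= => /andP[x1 x2]; apply/andP.
    split; last by rewrite ltr_pdivlMr// mulrC; lra.
    by rewrite -(pmulr_rgt0 _ r0); lra.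
  rewrite ltr_pdivlMr// mulrC in x2; split; first by lra.
  by have := mulr_gt0 r0 x1; lra.
rewrite pre in hL.
apply: le_trans (le_normr_Rintegral _ _) _ => //.
rewrite /Rintegral -lee_fin fineK; last first.
  apply: integrable_fin_num => //.
  exact: (integrable_norm ig).
have mg : measurable_fun `[0, b[ (fun t : R => f (L - r * t)).
  by have [/measurable_EFinP] := integrableP _ _ _ ig.
rewrite integral_itv_bndoo; last first.
  apply/measurable_EFinP; apply: measurableT_comp => //.
  by apply: measurable_funS mg => //; exact: subset_itv_oo_co.
have mhr : measurable_fun `]0, L / r[%classic (fun x => h (- r * x + L)%R).
  apply: (measurable_comp (measurable_itv `]0, L[)) => //.
    move=> _ [x xI <-]; have : ((fun x => - r * x + L) @^-1` `]0, L[%classic) x by rewrite pre.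
    by [].
  apply: measurable_funTS; apply: measurable_funD => //; exact: mulrl_measurable.
have sub : `]0, b[%classic `<=` `]0, L / r[%classic.
  by move=> x /=; rewrite !in_itv/= => /andP[-> /=] /lt_le_trans; apply.
apply: (@le_trans _ _ (\int[mu]_(x in `]0%R, b[) h (- r * x + L)%R)%E).
  apply: ge0_le_integral => //.
  - apply/measurable_EFinP; apply: measurableT_comp => //.
    by apply: measurable_funS mg => //; exact: subset_itv_oo_co.
  - exact: measurable_funS mhr.
  - move=> x _; rewrite /h lee_fin (_ : - r * x + L = L - r * x); last by ring.
    set g := f _.
    have -> : eta / 2 + (2 * eta)^-1 * g ^+ 2 =
        `|g| + (2 * eta)^-1 * (eta - `|g|) ^+ 2.
      rewrite -[g ^+ 2]real_normK ?num_real//; field; by rewrite gt_eqF.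
    by rewrite lerDl mulr_ge0 ?sqr_ge0.
apply: (@le_trans _ _ (\int[mu]_(x in `]0%R, (L / r)%R[) h (- r * x + L)%R)%E).
  exact: ge0_subset_integral.
rewrite -(@lee_pmul2l _ r%:E)//; apply: le_trans hL _.
rewrite -EFinM lee_fin.
have -> : r * ((L + 1) / r * eta) = (L + 1) * eta by field; rewrite gt_eqF.
have L1 : 0 <= (L + 1) * eta by rewrite mulr_ge0 ?(ltW eta0)//; lra.
by lra.
Qed.

(** Left of [s] the state comes from the boundary and is bounded by [c]; right of [s] it is a
    translate of the initial profile, which has left the interval once [s >= L]. *)
Lemma integral_sqr_transport_le L (s c eta : R) (f g : R -> R) :
  0 < L -> 0 <= s -> 0 <= eta ->
  measurable_fun `]0, L[ f -> measurable_fun `]0, L[ g ->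
  (\int[mu]_(x in `]0%R, L[) (f x ^+ 2)%:E <= (eta ^+ 2)%:E)%E ->
  (forall x, 0 < x < L -> x < s -> `|g x| <= c) ->
  (forall x, 0 < x < L -> s < x -> g x = f (x - s)) ->
  (\int[mu]_(x in `]0%R, L[) (g x ^+ 2)%:E <=
    (L * c ^+ 2 + (if s < L then eta ^+ 2 else 0))%:E)%E.
Proof.
move=> L0 s0 eta0 mf mg fL2 gc gf.
have mg2 : measurable_fun `]0, L[ (fun x => (g x ^+ 2)%:E).
  by apply/measurable_EFinP; exact: measurable_funX.
have mf2 : measurable_fun `]0, L[ (fun x => (f x ^+ 2)%:E).
  by apply/measurable_EFinP; exact: measurable_funX.
have g0 x : (0 <= (g x ^+ 2)%:E)%E by rewrite lee_fin sqr_ge0.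
have f0 x : (0 <= (f x ^+ 2)%:E)%E by rewrite lee_fin sqr_ge0.
have left_le (b : R) : b <= L -> b <= s ->
    (\int[mu]_(x in `]0%R, b[) (g x ^+ 2)%:E <= (L * c ^+ 2)%:E)%E.
  move=> bL bs; apply: (@le_trans _ _ (\int[mu]_(x in `]0%R, b[) (cst (c ^+ 2)%:E) x)%E).
    apply: ge0_le_integral => //.
    - apply: measurable_funS mg2 => //; apply: subset_itvl; rewrite bnd_simp//.
    - move=> x /=; rewrite in_itv/= => /andP[x0 xb].
      have xs : `|g x| <= c.
        by apply: gc; rewrite ?(lt_le_trans xb)// x0.
      rewrite lee_fin -real_normK ?num_real// lerXn2r ?nnegrE//.
      exact: le_trans xs.
  rewrite integral_cst//= lebesgue_measure_itv/= lte_fin.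
  case: ifPn => [b0|_]; last by rewrite mule0 lee_fin mulr_ge0 ?sqr_ge0// ltW.
  by rewrite sube0 -EFinM lee_fin mulrC ler_wpM2r ?sqr_ge0.
case: ifPn => [sL|]; last first.
  by rewrite -leNgt addr0 => Ls; apply: left_le.
(* The point [s], where nothing is known of [g], joins the left piece and is then dropped as
   negligible. *)
rewrite (@itv_bndbnd_setU _ _ _ (BRight s))//=.
rewrite ge0_integral_setU//=; last 2 first.
- rewrite -itv_bndbnd_setU//= ?bnd_simp//.
- apply/disj_setPLR => x/=; rewrite !in_itv/= => /andP[_ xs].
  by move=> /andP[]; rewrite ltNge xs.
rewrite -integral_itv_bndo_bndc; last first.
  by apply: measurable_funS mg2 => //; apply: subset_itvl; rewrite bnd_simp ltW.
rewrite EFinD; apply: leeD; first by apply: left_le; rewrite // ltW.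
have -> : (\int[mu]_(x in `]s, L[) (g x ^+ 2)%:E =
    \int[mu]_(x in `]s, L[) (f (1 * x + - s)%R ^+ 2)%:E)%E.
  apply: eq_integral => x; rewrite inE/= in_itv/= => /andP[sx xL].
  by rewrite gf ?mul1r// xL (le_lt_trans s0).
have sub : `]0, L - s[%classic `<=` `]0, L[%classic.
  by apply: subset_itvl; rewrite bnd_simp; lra.
have := @ge0_integral_affine R 1 (- s) `]0, L - s[%classic (fun x => (f x ^+ 2)%:E).
rewrite oner_neq0 normr1 mul1e.
have -> : (fun x => 1 * x + - s) @^-1` `]0, L - s[%classic = `]s, L[%classic.
  apply/seteqP; split=> x /=; rewrite !in_itv/= mul1r => /andP[x1 x2];
  by apply/andP; split; lra.
move=> /(_ isT (measurable_itv _)) <- //; last exact: measurable_funS mf2.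
by apply: le_trans fL2; exact: ge0_subset_integral.
Qed.

End L2_bounds.

(** * From mild solutions to the delay equation and back *)

Section mild_solutions.
Context {R : realType}.
Notation mu := (@lebesgue_measure R).
Variables (L r k : R) (z0 : (R -> R) * R) (phi : R -> R -> R) (xi : R -> R).
Hypotheses (L0 : 0 < L) (r0 : 0 < r) (k0 : 0 < k).
Hypotheses (z0Z : in_Z L z0) (sol : mild_solution L r k z0 phi xi).

Let T : R := L / r.
(** Stands in for [xi], with which it agrees at nonnegative times: as an explicit integral it is
    open to the fundamental theorem of calculus. *)
Definition trace_primitive (t : R) : R := z0.2 + \int[mu]_(s in `[0, t]) phi L s.
Let X := trace_primitive.

Let T0 : 0 < T. Proof. exact: divr_gt0. Qed.

Let rT : r * T = L. Proof. by rewrite /T mulrC divfK// gt_eqF. Qed.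

Lemma xi_trace_primitive t : 0 <= t -> xi t = X t.
Proof. exact: (mild_xi sol). Qed.

Lemma trace_primitive_continuous b : 0 <= b -> {within `[0, b], continuous X}.
Proof.
move=> b0 t.
apply: (@continuousD _ _ (subspace `[0, b]) (cst z0.2)); first exact: cst_continuous.
exact: (parameterized_integral_continuous b0 (mild_trace sol b0)).
Qed.

(** After time [T] the trace is the delayed boundary value, hence continuous, so its integral is
    differentiable. *)
Lemma trace_primitive_derive t : T < t -> is_derive t 1 X (- k * X (t - T)).
Proof.
move=> Tt; have t0 : 0 < t by apply: lt_trans Tt.
have tt1 : t < t + 1 by rewrite ltrDl.
have t1 : 0 <= t + 1 by rewrite addr_ge0// ltW.
have boundary s : T < s -> phi L s = - k * X (s - T).
  move=> Ts; have s0 : 0 < s by apply: lt_trans Ts.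
  rewrite (mild_boundary sol) ?lexx ?(ltW L0) ?(ltW s0)//.
    by rewrite xi_trace_primitive// subr_ge0 ltW.
  by rewrite -rT ltr_pM2l.
have cX : {for t - T, continuous X}.
  apply: (within_continuous_continuous t0 (trace_primitive_continuous (ltW t0))).
  by rewrite in_itv/= subr_gt0 Tt gtrBl.
have cphi : {for t, continuous (phi L)}.
  rewrite /prop_for /continuous_at boundary//.
  apply: cvg_trans; first apply: near_eq_cvg.
    near=> s; apply/esym/boundary; near: s; exact: lt_nbhsr.
  apply: cvgM; first exact: cvg_cst.
  apply: (@cvg_comp _ _ _ (fun s => s - T) X _ (nbhs (t - T))) => //.
  by apply: cvgB; [exact: cvg_id|exact: cvg_cst].
have [Fd FE] := continuous_FTC1_closed tt1 (mild_trace sol t1) t0 cphi.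
have H := is_derive_add (is_derive_cst z0.2 t 1) (DeriveDef Fd (erefl _)).
by apply: (is_derive_eq H); rewrite add0r -derive1E FE boundary.
Unshelve. all: by end_near. Qed.

Lemma trace_primitive_le_delay eta t : 0 < eta -> normZ L z0 <= eta ->
  0 <= t <= T -> `|X t| <= (1 + (L + 1) / r) * eta.
Proof.
move=> eta0 z0eta /andP[t0 tT].
have [fL2 z2] := normZ_le (ltW eta0) z0Z z0eta.
have [mf _] := z0Z.
(* The half-open interval avoids [s = T], where nothing is imposed on the trace. *)
have it : mu.-integrable `[0, t[ (EFin \o phi L).
  apply: integrableS (mild_trace sol t0) => //.
  by apply: subset_itvl; rewrite bnd_simp.
have E s : s \in `[0, t[%classic -> phi L s = z0.1 (L - r * s).
  rewrite inE/= in_itv/= => /andP[s0 st]; apply: (mild_init sol) => //.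
    by rewrite lexx ltW.
  by rewrite -rT ltr_pM2l// (lt_le_trans st).
rewrite /X /trace_primitive mulrDl mul1r.
apply: le_trans (ler_normD _ _) _; apply: lerD => //.
rewrite -(Rintegral_itv_bndo_bndc it).
have -> : \int[mu]_(s in `[0, t[) phi L s = \int[mu]_(s in `[0, t[) z0.1 (L - r * s).
  exact: eq_Rintegral.
apply: norm_Rintegral_reflected_le => //; first by rewrite t0.
by apply: eq_integrable it => // s sI /=; rewrite E.
Qed.

(** Method of steps: past [b], the mean value theorem bounds the increment by [k * T] times a value
    of [X] at a time in [[0, b]]. *)
Lemma trace_primitive_step (B b : R) : T <= b ->
  (forall t, 0 <= t <= b -> `|X t| <= B) ->
  forall t, 0 <= t <= b + T -> `|X t| <= (1 + k * T) * B.
Proof.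
move=> Tb XB t /andP[t0 tb].
have B0 : 0 <= B.
  by apply: le_trans (normr_ge0 (X 0)) (XB 0 _); rewrite lexx (le_trans (ltW T0)).
have kT0 : 0 < k * T by rewrite mulr_gt0.
have [tb'|bt] := leP t b.
  by apply: le_trans (XB t _) _; rewrite ?t0// ler_peMl//; lra.
have b0 : 0 <= b by rewrite (le_trans (ltW T0)).
have [||c cbt XE] := @MVT_segment R X (fun s => - k * X (s - T)) b t (ltW bt).
- move=> s; rewrite in_itv/= => /andP[bs _].
  by apply: trace_primitive_derive; rewrite (le_lt_trans Tb).
- apply: continuous_subspaceW (trace_primitive_continuous t0).
  by apply: subset_itvr; rewrite bnd_simp.
have -> : X t = X b + - k * X (c - T) * (t - b) by rewrite -XE addrC subrK.
apply: le_trans (ler_normD _ _) _; rewrite mulrDl mul1r; apply: lerD.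
  by apply: XB; rewrite b0 lexx.
move: cbt; rewrite in_itv/= => /andP[bc ct].
rewrite !normrM normrN (gtr0_norm k0) -mulrA -mulrA ler_pM2l// mulrC.
apply: ler_pM => //; first by rewrite ger0_norm; lra.
by apply: XB; apply/andP; split; lra.
Qed.

Lemma trace_primitive_le_5delay eta t : 0 < eta -> normZ L z0 <= eta ->
  0 <= t <= 5 * T -> `|X t| <= (1 + k * T) ^+ 4 * (1 + (L + 1) / r) * eta.
Proof.
move=> eta0 z0eta.
have T1 := fun t => @trace_primitive_le_delay eta t eta0 z0eta.
have T2 := trace_primitive_step (lexx T) T1.
have T3 := trace_primitive_step _ T2.
have T4 := trace_primitive_step _ (T3 _).
have T5 := trace_primitive_step _ (T4 _ _).
have -> : 5 * T = T + T + T + T + T by ring.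
move=> tT; have := T5 _ _ _ t tT.
have -> : (1 + k * T) ^+ 4 * (1 + (L + 1) / r) * eta =
  (1 + k * T) * ((1 + k * T) * ((1 + k * T) * ((1 + k * T) * ((1 + (L + 1) / r) * eta)))).
  by ring.
by apply; have := T0; lra.
Qed.

(** The part of the state issued from the boundary is [xi] delayed by at most [T], hence the factor
    [expR (w * T)]. The part issued from the initial profile is present only for [t < T], where
    [expR (w * (T - t)) >= 1]. *)
Lemma normZ_decay (M w eta t : R) : 0 <= M -> 0 < w -> 0 < eta -> normZ L z0 <= eta ->
  (forall s, 0 <= s -> `|xi s| <= M * expR (- w * s) * eta) -> 0 <= t ->
  normZ L (phi^~ t, xi t) <=
  Num.sqrt (L * (k * M * expR (w * T)) ^+ 2 + expR (w * T) ^+ 2 + M ^+ 2) *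
    (expR (- w * t) * eta).
Proof.
move=> M0 w0 eta0 z0eta xiM t0.
have [fL2 z2] := normZ_le (ltW eta0) z0Z z0eta.
have [mf _] := z0Z; have stZ := mild_state sol t0.
have e0 : 0 < expR (w * T) by exact: expR_gt0.
have c0 : 0 <= L * (k * M * expR (w * T)) ^+ 2 + expR (w * T) ^+ 2.
  by rewrite addr_ge0 ?sqr_ge0// mulr_ge0 ?sqr_ge0// ltW.
apply: le_normZ => //.
- by rewrite mulr_ge0 ?expR_ge0// ltW.
- set c := k * M * expR (w * T) * (expR (- w * t) * eta).
  have rt0 : 0 <= r * t by rewrite mulr_ge0// ltW.
  have [mg _] := stZ.
  apply: le_trans (@integral_sqr_transport_le R L (r * t) c eta z0.1 (phi^~ t)
     L0 rt0 (ltW eta0) mf mg fL2 _ _) _ => /=.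
  + move=> x /andP[x0 xL] xrt; rewrite (mild_boundary sol) ?(ltW x0) ?(ltW xL)//.
    rewrite normrM normrN (gtr0_norm k0) /c -!mulrA ler_pM2l//.
    have xt : x / r <= t by rewrite ler_pdivrMr// mulrC ltW.
    apply: le_trans (xiM _ _) _; first by rewrite subr_ge0.
    rewrite -mulrA ler_wpM2l// mulrA ler_pM2r// -expRD ler_expR.
    have xT : x / r <= T by rewrite ler_pM2r ?invr_gt0// ltW.
    have : w * (x / r) <= w * T by rewrite ler_pM2l.
    by move=> ?; lra.
  + by move=> x /andP[x0 xL] rtx; rewrite (mild_init sol) ?(ltW x0) ?(ltW xL).
  rewrite lee_fin mulrDl /c exprMn mulrA lerD2l.
  case: ifPn => [rtL|_]; last by rewrite mulr_ge0 ?sqr_ge0.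
  rewrite -exprMn mulrA -expRD exprMn ler_peMl ?sqr_ge0// -[leLHS](expr1n _ 2).
  rewrite lerXn2r ?nnegrE ?expR_ge0// -[leLHS]expR0 ler_expR.
  rewrite -[in ltRHS]rT ltr_pM2l// in rtL.
  by rewrite mulNr -mulrBr mulr_ge0 ?subr_ge0 ?ltW.
- by move: (xiM t t0); rewrite -mulrA.
Qed.

End mild_solutions.

Lemma stable_of_small_gain (R : realType) (L r k : R) :
  0 < L -> 0 < r -> 0 < k -> k * (L / r) < pi / 2 -> exponentially_stable L r k.
Proof.
move=> L0 r0 k0 kT; have T0 : 0 < L / r by exact: divr_gt0.
have [M0 M00 [w w0 H]] := delay_decay_scaled k0 T0 kT.
pose C := (1 + k * (L / r)) ^+ 4 * (1 + (L + 1) / r).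
have C0 : 0 < C.
  have kT0 : 0 < k * (L / r) by exact: mulr_gt0.
  have Lr0 : 0 < (L + 1) / r by apply: divr_gt0 => //; lra.
  by rewrite /C mulr_gt0 ?exprn_gt0//; lra.
pose M := M0 * C; have Mgt0 : 0 < M by exact: mulr_gt0.
pose K := Num.sqrt (L * (k * M * expR (w * (L / r))) ^+ 2 + expR (w * (L / r)) ^+ 2 + M ^+ 2).
have K0 : 0 < K.
  rewrite sqrtr_gt0 ltr_wpDl ?exprn_gt0// addr_ge0 ?sqr_ge0//.
  by rewrite mulr_ge0 ?sqr_ge0// ltW.
exists K, w; split=> // z0 phi xi z0Z sol t t0.
have Ke : 0 < K * expR (- w * t) by rewrite mulr_gt0 ?expR_gt0.
(* The preceding bounds divide by [eta] and need [eta > 0], whereas the initial norm may vanish: it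
   is approached from above. *)
apply/ler_addgt0Pr => e e0.
pose eta := normZ L z0 + e / (K * expR (- w * t)).
have eta0 : 0 < eta by rewrite ltr_wpDl ?sqrtr_ge0// divr_gt0.
have z0eta : normZ L z0 <= eta by rewrite lerDl divr_ge0// ltW.
have -> : K * expR (- w * t) * normZ L z0 + e = K * (expR (- w * t) * eta).
  by rewrite mulrA /eta mulrDr [X in _ = _ + X]mulrC divfK// gt_eqF.
apply: (normZ_decay L0 r0 k0 z0Z sol) => // [|s s0]; first exact: ltW.
rewrite (xi_trace_primitive sol)//.
have Xd := fun t => @trace_primitive_derive _ _ _ _ _ _ _ L0 r0 sol t.
have X5 := fun t =>
  @trace_primitive_le_5delay _ _ _ _ _ _ _ L0 r0 k0 z0Z sol eta t eta0 z0eta.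
have := H (trace_primitive L z0 phi) Xd (C * eta) X5 s s0.
by move=> /le_trans; apply; rewrite /M le_eqVlt; apply/orP; left; apply/eqP; ring.
Qed.

(** * Instability for large gains *)

Section instability.
Context {R : realType}.
Notation mu := (@lebesgue_measure R).

Lemma sin_le_id (x : R) : 0 <= x -> sin x <= x.
Proof.
move=> x0; have H t : 0 <= t <= x -> is_derive t 1 (fun s : R => s + - sin s) (1 + - cos t).
  by move=> _; exact: is_derive_add (is_derive_id t 1) (is_derive_opp (is_derive_sin t)).
have := is_derive_ge0_le x0 H; rewrite sin0 subrr subr_ge0; apply=> t _.
by rewrite subr_ge0 cos_le1.
Qed.

(* The root [th (- cot th + i)] of [z + K exp (- z) = 0] in the closed right
   half-plane, with [th] in [[pi / 2, pi[]. *)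
Lemma characteristic_angle (K : R) : pi / 2 <= K -> exists2 th : R, 0 < th &
  exists2 al : R, 0 <= al &
  - (K * expR (- al) * cos th) = al /\ K * expR (- al) * sin th = th.
Proof.
move=> piK; have pi2 := pi_ge2 R.
have K0 : 0 < K by lra.
(* Stopping at [pi - d] keeps [sin] positive, and [K * sin d <= K * d = pi / 2] gives the sign of
   [G] at the right end. *)
pose d := pi / 2 / K.
have d0 : 0 < d by rewrite divr_gt0//; lra.
have d1 : d <= 1 by rewrite ler_pdivrMr// mul1r.
pose b := pi - d.
have sin_pos (t : R) : pi / 2 <= t <= b -> 0 < sin t.
  by move=> /andP[h1 h2]; apply: sin_gt0_pi; rewrite /b in h2; apply/andP; split; lra.
(* Real part of the root as a function of its imaginary part [t]; the remaining equation is
   [G t = 0], solved by the intermediate value theorem. *)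
pose al (t : R) : R := - (t * (cos t / sin t)).
pose G (t : R) : R := t * expR (al t) + - (K * sin t).
have pib : pi / 2 <= b by rewrite /b; lra.
have b0 : 0 <= b by rewrite /b; lra.
have cG : {within `[pi / 2, b], continuous G}.
  apply: continuous_in_subspaceT => t; rewrite inE/= in_itv/= => /sin_pos st.
  have st0 : sin t != 0 by rewrite gt_eqF.
  have ald := is_derive_opp (is_derive_mul (is_derive_id t 1)
    (is_derive_mul (is_derive_cos t) (is_deriveV st0 (is_derive_sin t)))).
  have ed := @is_derive1_comp _ expR al _ _ _ (is_derive_expR _) ald.
  exact: is_derive_continuous (is_derive_add (is_derive_mul (is_derive_id t 1) ed)
    (is_derive_opp (is_derive_scale K (is_derive_sin t)))).
have cos_le0 (t : R) : pi / 2 <= t <= b -> cos t <= 0.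
  move=> /andP[h1 h2]; rewrite -[t](subrK (pi / 2)) cosDpihalf oppr_le0.
  rewrite le_eqVlt; apply/predU1P; have [->|t0] := eqVneq (t - pi / 2) 0.
    by left; rewrite sin0.
  right; apply: sin_gt0_pi; rewrite lt_neqAle eq_sym t0/=.
  by rewrite /b in h2; apply/andP; split; lra.
have al_ge0 t : pi / 2 <= t <= b -> 0 <= al t.
  move=> h; have /andP[h1 h2] := h; rewrite /al oppr_ge0 mulr_ge0_le0//; first by lra.
  by rewrite pmulr_lle0 ?cos_le0// invr_gt0 sin_pos.
have G1 : G (pi / 2) <= 0.
  rewrite /G /al cos_pihalf mul0r mulr0 oppr0 expR0 sin_pihalf; lra.
have G2 : 0 <= G b.
  rewrite /G subr_ge0.
  have -> : sin b = sin d by rewrite /b -[LHS]opprK -sinN opprB sinB sinpi cospi; ring.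
  apply: (@le_trans _ _ (pi / 2)).
    have -> : pi / 2 = K * d by rewrite /d [RHS]mulrC divfK// gt_eqF.
    by rewrite ler_pM2l// sin_le_id// ltW.
  have : 1 <= expR (al b) by rewrite -[leLHS]expR0 ler_expR al_ge0// pib lexx.
  move=> e1; exact: le_trans pib (ler_peMr b0 e1).
have [|t tI Gt] := IVT pib cG (_ : _ <= 0 <= _).
  by rewrite ge_min le_max G1 G2 orbT.
rewrite in_itv/= in tI; have st := sin_pos t tI.
have te : t * expR (al t) = K * sin t by apply/eqP; rewrite -subr_eq0 -[X in X == _]/(G t) Gt.
exists t; first by move: tI => /andP[]; lra.
exists (al t); first exact: al_ge0.
have e0 := expR_gt0 (al t).
have Ke : K * expR (- al t) * sin t = t.
  by rewrite expRN mulrAC -te mulfK// gt_eqF.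
split=> //.
transitivity (- (K * expR (- al t) * sin t * (cos t / sin t))); last by rewrite Ke.
by field; rewrite gt_eqF.
Qed.

Lemma continuous_integrable (f : R -> R) (a b : R) : continuous f ->
  mu.-integrable `[a, b] (EFin \o f).
Proof.
move=> cf; apply: continuous_compact_integrable; first exact: segment_compact.
exact: continuous_subspaceT.
Qed.

Lemma continuous_in_L2 (L : R) (f : R -> R) : continuous f -> in_L2 L f.
Proof.
move=> cf; split; first by apply: measurable_funTS; exact: continuous_measurable_fun.
have cf2 : continuous (fun x => f x ^+ 2).
  by move=> x; apply: (@continuousM _ _ f f); exact: cf.
apply: integrableS (continuous_integrable 0 L cf2) => //.
exact: subset_itv_oo_cc.
Qed.

Lemma unstable_of_large_gain (L r k : R) : 0 < L -> 0 < r -> 0 < k ->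
  pi / 2 <= k * (L / r) -> ~ exponentially_stable L r k.
Proof.
move=> L0 r0 k0 /characteristic_angle[th th0 [al al0 [alE thE]]].
set T := L / r in alE thE; have T0 : 0 < T by exact: divr_gt0.
pose a := al / T; pose b := th / T.
(* Real part of the exponential attached to the root, divided by [T] to restore the time scale. The
   [+ 0] fits [is_derive_comp_affine]. *)
pose xi (t : R) := expR (a * t + 0) * cos (b * t + 0).
(* As [xi] solves the delay equation at all real times, one formula serves on both sides of
   [x = r t] and also gives the initial profile. *)
pose phi (x t : R) := - k * xi (t - x / r).
have xi_derive (t : R) : is_derive t 1 xi (- k * xi (t - T)).
  apply: (is_derive_eq (is_derive_mul
    (is_derive_comp_affine (is_derive_expR (a * t + 0)))
    (is_derive_comp_affine (is_derive_cos (b * t + 0))))).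
  rewrite /xi !addr0 !mulrBr.
  have -> : a * T = al by rewrite /a divfK// gt_eqF.
  have -> : b * T = th by rewrite /b divfK// gt_eqF.
  rewrite expRD cosB.
  have aE : a = - (k * expR (- al) * cos th).
    by rewrite /a -{1}alE; field; rewrite gt_eqF.
  have bE : b = k * expR (- al) * sin th.
    by rewrite /b -{1}thE; field; rewrite gt_eqF.
  set e := expR (a * t); set c := cos (b * t); set s := sin (b * t).
  by rewrite aE bE; ring.
have xi_cont : continuous xi by move=> t; exact: is_derive_continuous (xi_derive t).
have comp_cont (g : R -> R) : continuous g -> continuous (fun x => - k * xi (g x)).
  move=> cg x; apply: cvgM; first exact: cvg_cst.
  by apply: (@cvg_comp _ _ _ g xi); [exact: cg|exact: xi_cont].
have phix_cont t : continuous (phi^~ t).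
  apply: (comp_cont (fun x => t - x / r)) => x.
  by apply: cvgB; [exact: cvg_cst|apply: cvgM; [exact: cvg_id|exact: cvg_cst]].
have phit_cont x : continuous (phi x).
  apply: (comp_cont (fun t => t - x / r)) => t.
  by apply: cvgB; [exact: cvg_id|exact: cvg_cst].
pose z0 : (R -> R) * R := (phi^~ 0, 1).
have xi0 : xi 0 = 1 by rewrite /xi !mulr0 addr0 expR0 cos0 mulr1.
have sol : mild_solution L r k z0 phi xi.
  split.
  - by move=> t _; exact: (continuous_in_L2 L (phix_cont t)).
  - by move=> t _; exact: (continuous_integrable 0 t (phit_cont L)).
  - move=> t; rewrite le_eqVlt => /predU1P[<-|t0].
      by rewrite set_itv1 Rintegral_set1 addr0 xi0.
    rewrite /Rintegral (continuous_FTC2 (F := xi) t0) //=.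
    + by rewrite /= xi0; ring.
    + exact: continuous_subspaceT.
    + split; first by move=> s _; have [] := xi_derive s.
        by apply: cvg_at_right_filter; exact: xi_cont.
      by apply: cvg_at_left_filter; exact: xi_cont.
    + by move=> s _; rewrite derive1E; have [_ ->] := xi_derive s.
  - move=> x t _ _ _; rewrite /z0 /phi/=; congr (- k * xi _).
    by field; rewrite gt_eqF.
  - by [].
move=> [M [w [M0 w0 H]]].
have z0Z : in_Z L z0 by exact: (continuous_in_L2 L (phix_cont 0)).
have {}H t t0 := H z0 phi xi z0Z sol t t0.
set N := normZ L z0 in H.
have N0 : 0 <= N by rewrite sqrtr_ge0.
have b0 : 0 < b by exact: divr_gt0.
(* At [t = 2 pi n / b] the cosine is [1], so [|xi t| >= 1]. This [n] makes [w * t] exceed [M * N],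
   and [expR (w * t) >= 1 + w * t] then contradicts the decay. *)
pose n := Num.bound (M * N / w * b).
pose t := n%:R * (pi *+ 2) / b.
have pi2 := pi_ge2 R.
have t0 : 0 <= t by rewrite /t divr_ge0 ?(ltW b0)// mulr_ge0// mulr2n; lra.
have xit : 1 <= `|xi t|.
  rewrite /xi !addr0.
  have -> : b * t = 0 + (pi *+ 2) *+ n.
    by rewrite /t add0r -[in RHS]mulr_natl; field; rewrite gt_eqF.
  rewrite (periodicn (@cosD2pi R)) cos0 mulr1 ger0_norm ?expR_ge0//.
  by rewrite -[leLHS]expR0 ler_expR mulr_ge0// divr_ge0// ltW.
have xiN : `|xi t| <= normZ L (phi^~ t, xi t).
  rewrite -sqrtr_sqr; apply: ler_wsqrtr; rewrite /dotZ expr2 lerDr.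
  by apply: Rintegral_ge0 => x _; rewrite -expr2 sqr_ge0.
have := le_trans xit (le_trans xiN (H t t0)).
rewrite mulNr expRN mulrAC ler_pdivlMr ?expR_gt0// mul1r leNgt => /negP; apply.
apply: lt_le_trans (expR_ge1Dx _).
have nb : M * N / w * b < n%:R.
  apply: archi_boundP; apply: mulr_ge0 (ltW b0).
  exact: divr_ge0 (mulr_ge0 (ltW M0) N0) (ltW w0).
have : M * N / w < t.
  rewrite /t ltr_pdivlMr//; apply: lt_le_trans nb _.
  by rewrite ler_peMr// mulr2n; lra.
by rewrite ltr_pdivrMr// mulrC => ?; lra.
Qed.

End instability.

Unset Implicit Arguments.
Set Strict Implicit.

Theorem proposition1 (R : realType) (L r kI : R)
    (L_gt0 : 0 < L) (r_gt0 : 0 < r) (kI_gt0 : 0 < kI) :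
  exponentially_stable L r kI <-> kI \in `]0, (r * pi / (2 * L))[.
Proof.
have gainE : (kI < r * pi / (2 * L)) = (kI * (L / r) < pi / 2).
  rewrite -(ltr_pM2r (divr_gt0 L_gt0 r_gt0)); congr (_ < _).
  by field; rewrite !gt_eqF.
rewrite in_itv/= kI_gt0 gainE; split; last exact: stable_of_small_gain.
rewrite ltNge => st; apply/negP => gain.
exact: unstable_of_large_gain L_gt0 r_gt0 kI_gt0 gain st.
Qed.
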